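(* Let $(G_n)_{n\ge 1}$ be a sequence of finite groups with orders increasing to infinity such that the limit $\lim_{n\to\infty}\Delta(G_n)$ exists and is $>0$. Then this limit is of the form $1/l$ for some positive integer $l$.
   Context: For a finite group $G$, $d(G)$ denotes the least integer $d$ such that $G$ embeds in the symmetric group $S_d$ (equivalently, the smallest size of a set on which $G$ acts faithfully), and $\Delta(G)=d(G)/|G|$. *)

(* Defs.v *)
From mathcomp Require Import all_boot all_order all_fingroup all_algebra.
From mathcomp Require Import all_classical all_reals all_analysis.

Set Implicit Arguments.
Unset Strict Implicit.
Unset Printing Implicit Defensive.

Import Order.TTheory GRing.Theory Num.Theory.
Import GroupScope.

Definition embeds_in_Sym (gT : finGroupType) (G : {group gT}) (d : nat) : bool :=
  [exists H : {group 'S_d}, G \isog H].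

(* Cayley's theorem, via right multiplication on the ambient type. *)
Lemma embeds_in_Sym_ex (gT : finGroupType) (G : {group gT}) :
  exists d, embeds_in_Sym G d.
Proof.
exists #|gT|.
pose to (i : 'I_#|gT|) (x : gT) := enum_rank (enum_val i * x).
have to1 : to^~ 1 =1 id by move=> i; rewrite /to mulg1 enum_valK.
have toM i : act_morph to i by move=> x y; rewrite /to enum_rankK mulgA.
pose act := TotalAction to1 toM.
have inj : 'injm (actperm act).
  apply/injmP => x y _ _ /permP/(_ (enum_rank 1)).
  rewrite !actpermE /= /to enum_rankK !mul1g.
  exact: enum_rank_inj.
apply/existsP; exists (actperm act @* G)%G.
by apply: (sub_isog _ inj); apply: finset.subsetT.
Qed.

Definition min_perm_degree (gT : finGroupType) (G : {group gT}) : nat :=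
  ex_minn (embeds_in_Sym_ex G).

Definition Delta (R : realType) (gT : finGroupType) (G : {group gT}) : R :=
  ((min_perm_degree G)%:R / #|G|%:R)%R.

(* Main.v *)
Require Import Defs.
From mathcomp Require Import all_boot all_order all_fingroup all_solvable.

(** Everything rests on one observation. Let C be a nontrivial cyclic p-subgroup
    of G, and Z its unique subgroup of order p. In a faithful permutation
    representation of degree d(G), some point is moved by Z; its stabiliser H
    does not contain Z, and its orbit gives |G : H| <= d(G). Conversely, every
    nontrivial subgroup of C contains Z, so H :&: C = 1 and G acts faithfully on
    the disjoint union of G / H and G / C; hence d(G) <= |G : H| + |G : C|.
    Dividing by |G|, one gets 1 / |H| <= Delta(G) <= 1 / |H| + 1 / |C|
    ([Delta_cyclic_pgroup]): Delta(G) is as close to the inverse of an integer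
    as C is large.

    It remains to find large cyclic p-subgroups. If two subgroups K and L of G
    meet trivially, then in the same way Delta(G) <= 1 / |K| + 1 / |L|
    ([Delta_TI]), so that a lower bound on Delta(G) forbids K and L both large.
    A group all of whose cyclic p-subgroups are bounded while its order is huge
    does contain such K and L ([large_cyclic_or_TI_pair]): only boundedly many
    primes divide |G|, so some Sylow subgroup P is huge; a maximal abelian
    normal subgroup A of P is its own centraliser in P, so |P| is bounded in
    terms of |A| and A is huge; A has bounded exponent, so it has large rank and
    contains a large elementary abelian group, which splits into two large
    factors.

    Hence the limit x > 0 is approximated arbitrarily well by inverses of
    positive integers. These accumulate only at 0, so x is one of them
    ([invn_discrete]). *)

Set Implicit Arguments.
Unset Strict Implicit.
Unset Printing Implicit Defensive.

(** * Permutation degree and subgroups with trivial intersection *)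

Section PermutationDegree.

Import GroupScope.

Lemma embeds_in_Sym_faithful (gT : finGroupType) (G : {group gT}) (T : finType)
    (to : {action gT &-> T}) (S : {set T}) :
  [acts G, on S | to] -> [faithful G, on S | to] -> embeds_in_Sym G #|S|.
Proof.
move=> nSG /faithfulP ffulG.
have stab g (i : 'I_#|S|) : g \in G -> to (enum_val i) g \in S.
  by move=> Gg; rewrite (acts_act nSG) ?enum_valP.
have [S0 | [x0 Sx0]] := set_0Vmem S.
  have G1 : G :=: 1.
    apply/trivgP/subsetP => g Gg; rewrite inE (ffulG g) // => x.
    by rewrite S0 inE.
  by apply/existsP; exists 1%G; rewrite trivial_isog.
(* Transport of the action from S to its index type; elements outside G are
   made to act trivially. *)
pose sto (i : 'I_#|S|) g :=
  if g \in G then enum_rank_in Sx0 (to (enum_val i) g) else i.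
have stoE g i : g \in G -> enum_val (sto i g) = to (enum_val i) g.
  by move=> Gg; rewrite /sto Gg enum_rankK_in ?stab.
have sto_act : is_action G sto.
  split=> [g i j | i g h Gg Gh].
    have [Gg | /negPf nGg] := boolP (g \in G); last by rewrite /sto nGg.
    by move=> /(congr1 enum_val); rewrite !stoE // => /act_inj/enum_val_inj.
  by apply: enum_val_inj; rewrite !stoE ?groupM // actM.
have injf : 'injm (actperm (Action sto_act)).
  apply/subsetP => g; rewrite ker_actperm => /setIP[Gg].
  rewrite inE => /subsetP fix_g.
  rewrite (ffulG g) ?inE // => x Sx.
  have := fix_g (enum_rank_in Sx x) (in_setT _).
  by rewrite inE /= => /eqP/(congr1 enum_val); rewrite stoE // !enum_rankK_in.
apply/existsP; exists (actperm (Action sto_act) @* G)%G.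
exact: (sub_isog _ injf).
Qed.

Lemma min_perm_degree_le (gT : finGroupType) (G : {group gT}) d :
  embeds_in_Sym G d -> min_perm_degree G <= d.
Proof. by rewrite /min_perm_degree; case: ex_minnP => m _; apply. Qed.

(** The cosets of K and those of L, taken together, form a faithful G-set: an
    element of the kernel fixes the cosets K and L, so it lies in K :&: L. *)
Lemma min_perm_degree_TI (gT : finGroupType) (G K L : {group gT}) :
    K \subset G -> L \subset G -> K :&: L = 1 ->
  min_perm_degree G <= #|G : K| + #|G : L|.
Proof.
move=> sKG sLG tiKL.
have /min_perm_degree_le : embeds_in_Sym G #|rcosets K G :|: rcosets L G|.
  apply: (@embeds_in_Sym_faithful _ _ _ 'Rs%act).
    by rewrite actsU // actsRs_rcosets.
  rewrite /faithful -tiKL; apply/subsetP => g /setIP[Gg /astabP fix_g].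
  have in_stab (H : {group gT}) :
      (H : {set gT}) \in rcosets K G :|: rcosets L G -> g \in H.
    by move=> /fix_g /= HgE; rewrite -HgE rcosetE rcoset_refl.
  have rcos1 (H : {group gT}) : (H : {set gT}) \in rcosets H G.
    by apply/rcosetsP; exists 1; rewrite ?group1 ?rcoset1.
  by rewrite inE !in_stab // inE rcos1 ?orbT.
by move/leq_trans; apply; apply: leq_card_setU.
Qed.

(** In a faithful representation of least degree, a nontrivial element of Z moves
    some point; H is the stabiliser of that point, and the index of H is the
    length of its orbit. *)
Lemma stabiliser_min_perm_degree (gT : finGroupType) (G Z : {group gT}) :
    Z \subset G -> Z :!=: 1 ->
  exists H : {group gT},
    [/\ H \subset G, ~~ (Z \subset H) & #|G : H| <= min_perm_degree G].
Proof.
rewrite /min_perm_degree; case: ex_minnP => d /existsP[H0 /isogP[f injf fG]] _.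
move=> sZG /trivgPn[z Zz nz1].
have Gz := subsetP sZG z Zz.
have [i fzi] : exists i, f z i != i.
  apply/existsP; apply: contraR nz1; rewrite negb_exists => /forallP fix_f.
  rewrite -(morph_injm_eq1 injf) //; apply/eqP/permP => i.
  by apply/eqP; rewrite perm1 -[_ == _]negbK.
exists (f @*^-1 'C[i | 'P])%G; split.
- exact: subsetIl.
- apply: contra fzi => /subsetP/(_ z Zz); rewrite !inE => /andP[_].
  by rewrite sub1set inE.
- have -> : #|G : f @*^-1 'C[i | 'P]| = #|orbit 'P (f @* G) i|.
    rewrite card_orbit indexgI -(@index_morphpre _ _ _ f) // morphimK //.
    by rewrite (trivgP injf) mul1g.
  by apply: leq_trans (max_card _) _; rewrite card_ord.
Qed.

(** A cyclic p-group C has a unique minimal subgroup, ['Ohm_1(C)], so a point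
    stabiliser H that does not contain ['Ohm_1(C)] meets C trivially. *)
Lemma cyclic_pgroup_min_perm_degree (gT : finGroupType) (G C : {group gT})
    (p : nat) :
    C \subset G -> cyclic C -> p.-group C -> C :!=: 1 ->
  exists H : {group gT}, H \subset G /\
    #|G : H| <= min_perm_degree G <= #|G : H| + #|G : C|.
Proof.
move=> sCG cycC pC ntC.
have sZC : 'Ohm_1(C) \subset C by apply: Ohm_sub.
have [|| H [sHG nsZH le_d]] := @stabiliser_min_perm_degree _ G 'Ohm_1(C)%G.
- exact: subset_trans sCG.
- by rewrite /= Ohm1_eq1.
exists H; split=> //; rewrite le_d /=.
apply: min_perm_degree_TI => //; apply: TI_Ohm1.
rewrite setIC; apply: prime_TIg => //.
by rewrite (Ohm1_cyclic_pgroup_prime cycC pC ntC); case: (pgroup_pdiv pC ntC).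
Qed.

(** * Large groups with bounded cyclic p-subgroups *)

(** P / A acts faithfully on A by conjugation. *)
Lemma card_self_centralising (gT : finGroupType) (P A : {group gT}) :
  A <| P -> 'C_P(A) = A -> #|P| <= #|A| * #|A|`!.
Proof.
move=> /andP[sAP nAP] cAA.
rewrite -(Lagrange sAP) leq_mul2l -card_quotient //; apply/orP; right.
rewrite -card_perm.
have <- : #|conj_aut A @* P| = #|P / A|.
  by rewrite card_morphim ker_conj_aut (setIidPr nAP) -indexgI cAA card_quotient.
apply: subset_leq_card; apply: subset_trans (Aut_conj_aut _ _) _.
by apply/subsetP => a; rewrite inE => /andP[].
Qed.

Lemma leq_prod_expn (T : eqType) (s : seq T) (f : T -> nat) b :
  (forall x, x \in s -> f x <= b) -> \prod_(x <- s) f x <= b ^ size s.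
Proof.
move=> le_b; rewrite -iter_muln_1 -(count_predT s) -big_const_seq.
by rewrite big_seq [leqRHS]big_seq leq_prod.
Qed.

Lemma card_abelian_rank (gT : finGroupType) (A : {group gT}) q :
    abelian A -> (forall x, x \in A -> #[x] <= q) -> #|A| <= q ^ 'r(A).
Proof.
move=> abA leq_q; have [b defA def_t] := abelian_structure abA.
rewrite -size_abelian_type // -def_t -(bigdprod_card defA) size_map.
apply: leq_prod_expn => x bx; apply: leq_q.
rewrite -cycle_subG -(bigdprodWY defA) sub_gen //.
by rewrite (big_rem x) //= subsetUl.
Qed.

(** A subgroup K of order p ^ s has a complement L in E. *)
Lemma abelem_TI_pair (gT : finGroupType) (E : {group gT}) p s :
    prime p -> p.-abelem E -> p ^ (s + s) %| #|E| ->
  exists K L : {group gT},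
    [/\ K \subset E, L \subset E, K :&: L = 1, p ^ s <= #|K| & p ^ s <= #|L|].
Proof.
move=> p_pr abE dvE; have pE := abelem_pgroup abE.
have le_s : s <= logn p #|E|.
  by apply: leq_trans (leq_addr s s) _; rewrite -pfactor_dvdn.
have [K [sKE _ cardK]] := normal_pgroup pE (normal_refl E) le_s.
have [L /dprodP[_ defE _ tiKL]] := abelem_split_dprod abE sKE.
exists K, L; split=> //; first by rewrite -defE mulG_subr.
  by rewrite cardK.
have := TI_cardMg tiKL; rewrite defE cardK => cardE.
have := dvdn_leq (cardG_gt0 E) dvE.
by rewrite cardE expnD leq_pmul2l // expn_gt0 prime_gt0.
Qed.

(** An abelian p-group with more than [abelian_bound q] elements, each of order at
    most q, has rank greater than q + q; it thus contains the direct product of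
    two elementary abelian groups of rank q. *)
Definition abelian_bound q := (q ^ (q + q))%N.
(** The bound that [card_self_centralising] gives on the order of a p-group in
    which a self-centralising normal subgroup has order at most
    [abelian_bound q]. *)
Definition pgroup_bound q := (abelian_bound q * (abelian_bound q)`!)%N.

Lemma pgroup_TI_pair (gT : finGroupType) (P : {group gT}) (p : nat) q :
    p.-group P -> (forall x, x \in P -> #[x] <= q) -> pgroup_bound q < #|P| ->
  exists K L : {group gT},
    [/\ K \subset P, L \subset P, K :&: L = 1, q <= #|K| & q <= #|L|].
Proof.
move=> pP le_q ltP.
have q_gt0 : 0 < q by apply: leq_trans (le_q 1 (group1 P)); rewrite order1.
have [A maxA _] : {A : {group gT} | [max A | A <| P & abelian A] & [1] \subset A}.
  by apply: maxgroup_exists; rewrite normal1 abelian1.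
have /andP[nsAP abA] := maxgroupp maxA.
have /SCN_P[_ cAA] := max_SCN pP maxA.
have sAP := normal_sub nsAP.
have ltA : abelian_bound q < #|A|.
  rewrite ltnNge; apply: contraL ltP => leA; rewrite -leqNgt.
  apply: leq_trans (card_self_centralising nsAP cAA) _.
  by rewrite leq_mul // leq_fact.
have leA : #|A| <= q ^ 'r(A).
  by apply: card_abelian_rank => // x Ax; apply/le_q/(subsetP sAP).
have lt_r : q + q < 'r(A).
  rewrite ltnNge; apply/negP => le_r; have := leq_trans ltA leA.
  by rewrite ltnNge leq_pexp2l.
have ntP : P :!=: 1.
  rewrite -cardG_gt1; apply: leq_trans ltP.
  by rewrite ltnS muln_gt0 fact_gt0 expn_gt0 q_gt0.
have [p_pr _ _] := pgroup_pdiv pP ntP.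
have [E EA] := p_rank_witness p A.
have [sEA abE oE] := pnElemPcard EA.
have dvE : p ^ (q + q) %| #|E|.
  by rewrite oE -(rank_pgroup (pgroupS sAP pP)) dvdn_exp2l ?(ltnW lt_r).
have [K [L [sKE sLE tiKL leK leL]]] := abelem_TI_pair p_pr abE dvE.
have sEP := subset_trans sEA sAP.
have le_pq : q <= p ^ q by apply/ltnW/ltn_expl/prime_gt1.
by exists K, L; split; rewrite ?(subset_trans _ sEP) ?(leq_trans le_pq).
Qed.

(** The order of G is the product of the orders of its Sylow subgroups, and there
    are at most q of them, one for each prime divisor. *)
Lemma large_pgroup (gT : finGroupType) (G : {group gT}) q b :
    (forall p, p \in primes #|G| -> p <= q) -> 0 < b -> (b ^ q)%N < #|G| ->
  exists2 p, p \in primes #|G| &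
    exists P : {group gT}, [/\ P \subset G, p.-group P & b < #|P|].
Proof.
move=> le_q b_gt0 ltG.
have [/hasP[p pG ltb] | /hasPn le_b] :=
    boolP (has (fun p : nat => b < #|G|`_p) (primes #|G|)).
  have [P sylP] := Sylow_exists p G; exists p => //; exists P.
  by rewrite (pHall_sub sylP) (pHall_pgroup sylP) (card_Hall sylP).
move: ltG; rewrite ltnNge; case/negP.
rewrite [leqLHS]prod_prime_decomp ?cardG_gt0 // prime_decompE big_map /=.
apply: (@leq_trans (b ^ size (primes #|G|))).
  by apply: leq_prod_expn => p /le_b; rewrite -leqNgt p_part.
rewrite leq_pexp2l //.
rewrite -(size_iota 1 q) uniq_leq_size ?primes_uniq // => p pG.
move: (pG); rewrite mem_primes mem_iota => /and3P[p_pr _ _].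
by rewrite prime_gt0 // add1n ltnS le_q.
Qed.

(** If the elements of prime power order have order at most q, then so do those
    of prime order, and Cauchy's theorem bounds the prime divisors of |G| by q. *)
Lemma large_cyclic_or_TI_pair q :
    exists N, forall (gT : finGroupType) (G : {group gT}), N < #|G| ->
  (exists p : nat, exists2 x, x \in G & p.-elt x && (q < #[x])) \/
  (exists K L : {group gT},
    [/\ K \subset G, L \subset G, K :&: L = 1, q <= #|K| & q <= #|L|]).
Proof.
exists (pgroup_bound q ^ q)%N => gT G ltG.
have [/hasP[p _ /exists_inP[x Gx px]] | /hasPn no_x] :=
    boolP (has (fun p : nat => [exists x in G, p.-elt x && (q < #[x])])
               (primes #|G|)).
  by left; exists p, x.
right.
have le_q p x : p \in primes #|G| -> x \in G -> p.-elt x -> #[x] <= q.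
  move=> pG Gx px; rewrite leqNgt; apply: contra (no_x p pG) => ltx.
  by apply/exists_inP; exists x; rewrite // px.
have le_pq p : p \in primes #|G| -> p <= q.
  move=> pG; move: (pG); rewrite mem_primes => /and3P[p_pr _ dvp].
  have [x Gx ox] := Cauchy p_pr dvp.
  by rewrite -ox; apply: le_q pG Gx _; rewrite /p_elt ox pnat_id.
have b_gt0 : 0 < pgroup_bound q by rewrite muln_gt0 fact_gt0 expn_gt0; case: (q).
have [p pG [P [sPG pP ltP]]] := large_pgroup le_pq b_gt0 ltG.
have [|K [L [sKP sLP tiKL leK leL]]] := pgroup_TI_pair pP _ ltP.
  move=> x Px; apply: le_q pG _ (mem_p_elt pP Px); exact: (subsetP sPG).
by exists K, L; split=> //; apply: subset_trans sPG.
Qed.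

End PermutationDegree.

(** * Passage to the limit *)

From mathcomp Require Import all_algebra lra.
From mathcomp Require Import all_classical all_reals all_analysis.

Import Order.TTheory GRing.Theory Num.Theory.
Import numFieldNormedType.Exports.
Local Open Scope classical_set_scope.
Local Open Scope ring_scope.

Lemma index_ratio (R : realType) (gT : finGroupType) (G H : {group gT}) :
  H \subset G -> #|G : H|%g%:R / #|G|%:R = #|H|%:R^-1 :> R.
Proof.
move=> sHG; rewrite -(Lagrange sHG) natrM invfM mulrCA mulfV ?mulr1 //.
by rewrite pnatr_eq0 -lt0n indexg_gt0.
Qed.

Lemma Delta_TI (R : realType) (gT : finGroupType) (G K L : {group gT}) :
    K \subset G -> L \subset G -> (K :&: L = 1)%g ->
  Delta R G <= #|K|%:R^-1 + #|L|%:R^-1.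
Proof.
move=> sKG sLG tiKL; rewrite -(index_ratio R sKG) -(index_ratio R sLG) -mulrDl.
rewrite ler_wpM2r ?invr_ge0 ?ler0n // -natrD ler_nat.
exact: min_perm_degree_TI.
Qed.

(** The integer l is the order of the stabiliser in
    [cyclic_pgroup_min_perm_degree]. *)
Lemma Delta_cyclic_pgroup (R : realType) (gT : finGroupType) (G C : {group gT})
    (p : nat) :
    C \subset G -> cyclic C -> (p.-group C)%g -> (C :!=: 1)%g ->
  exists2 l, (0 < l)%N & l%:R^-1 <= Delta R G <= l%:R^-1 + #|C|%:R^-1.
Proof.
move=> sCG cycC pC ntC.
have [H [sHG /andP[le_d d_le]]] := cyclic_pgroup_min_perm_degree sCG cycC pC ntC.
exists #|H|; first exact: cardG_gt0.
rewrite -(index_ratio R sHG) -(index_ratio R sCG) -mulrDl.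
by rewrite !ler_wpM2r ?invr_ge0 ?ler0n // -?natrD ler_nat.
Qed.

(** An approximation of x by some 1 / l within x / 2 forces l <= 2 / x, and the
    finitely many 1 / l with l in this range, if all different from x, stay at a
    positive distance from x. *)
Lemma invn_discrete (R : realType) (x : R) : 0 < x ->
    (forall e, 0 < e -> exists2 l, (0 < l)%N & `|x - l%:R^-1| <= e) ->
  exists2 l, (0 < l)%N & x = l%:R^-1.
Proof.
move=> x_gt0 approx; apply: contrapT => not_inv.
have apart m : exists2 d : R, 0 < d &
    forall l, (0 < l < m)%N -> d <= `|x - l%:R^-1|.
  elim: m => [|m [d d_gt0 le_d]]; first by exists 1 => // l; rewrite andbF.
  have [m0 | m_gt0] := posnP m.
    by exists 1 => // l /andP[]; rewrite m0; case: l.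
  exists (Num.min d `|x - m%:R^-1|).
    rewrite lt_min d_gt0 normr_gt0 subr_eq0; apply/eqP => xm.
    by apply: not_inv; exists m.
  move=> l /andP[l_gt0]; rewrite ltnS leq_eqVlt => /orP[/eqP->|ltlm].
    by rewrite ge_min lexx orbT.
  by rewrite ge_min le_d ?l_gt0.
have [d d_gt0 le_d] := apart (Num.truncn (2 / x)).+1.
have e_gt0 : 0 < Num.min (d / 2) (x / 2) by rewrite lt_min !divr_gt0.
have [l l_gt0] := approx _ e_gt0; rewrite le_min => /andP[le_d2 le_x2].
have l0 : 0 < l%:R :> R by rewrite ltr0n.
have : x / 2 <= l%:R^-1 by move: le_x2; rewrite ler_norml; lra.
rewrite -(ler_pM2r l0) mulVf ?gt_eqF // => le1.
have : l%:R <= 2 / x by rewrite ler_pdivlMr //; lra.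
rewrite -truncn_ge_nat ?divr_ge0 ?(ltW x_gt0) // -ltnS => lt_l.
have := le_d l; rewrite l_gt0 lt_l => /(_ isT); lra.
Qed.

Theorem theorem4p6 (R : realType) (gT : nat -> finGroupType)
    (G : forall n : nat, {group gT n})
    (G_incr : {homo (fun n => #|G n|) : m n / (m <= n)%N >-> (m <= n)%N})
    (G_infty : (fun n => #|G n|) @ \oo --> \oo)
    (Delta_cvg : cvg ((fun n => Delta R (G n)) @ \oo))
    (Delta_gt0 : 0 < lim ((fun n => Delta R (G n)) @ \oo)) :
  exists2 l : nat, (0 < l)%N & lim ((fun n => Delta R (G n)) @ \oo) = l%:R^-1.
Proof.
set x := lim _ in Delta_gt0 *; apply: invn_discrete => // e e_gt0.
(* The bound x / 5 excludes the pair of subgroups: it would give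
   4 x / 5 < Delta <= 2 / q <= 2 x / 5. *)
have r_gt0 : 0 < Num.min (e / 2) (x / 5) by rewrite lt_min !divr_gt0.
have [q] : exists q : nat, (0 < q)%N /\ q%:R^-1 <= Num.min (e / 2) (x / 5).
  exists (Num.truncn (Num.min (e / 2) (x / 5))^-1).+1; split => //.
  by rewrite invf_ple ?posrE ?ltr0n // ltW // truncnS_gt.
rewrite le_min => -[q_gt0 /andP[le_e le_x]].
have [N largeN] := large_cyclic_or_TI_pair q.
have : \forall n \near \oo, `|x - Delta R (G n)| < Num.min (e / 2) (x / 5).
  by have /cvgrPdist_lt := Delta_cvg; apply.
have : \forall n \near \oo, (N < #|G n|)%N by apply: G_infty (nbhs_infty_gt N).
move=> near_ltN near_lim; near \oo => n.
have ltN : (N < #|G n|)%N by near: n.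
have : `|x - Delta R (G n)| < Num.min (e / 2) (x / 5) by near: n.
rewrite lt_min => /andP[near_e near_x].
have invq m : (q <= m)%N -> m%:R^-1 <= q%:R^-1 :> R.
  by move=> leqm; rewrite lef_pV2 ?ler_nat // posrE ltr0n // (leq_trans q_gt0).
have [[p [y Gy /andP[py ltq]]] | [K [L [sKG sLG tiKL leK leL]]]] := largeN _ _ ltN.
  have [||||l l_gt0 bound] := @Delta_cyclic_pgroup R _ (G n) <[y]>%G p.
  - by rewrite cycle_subG.
  - exact: cycle_cyclic.
  - by [].
  - by rewrite -cardG_gt1; apply: leq_trans ltq.
  exists l => //; move: bound near_e (invq _ (ltnW ltq)) le_e.
  rewrite ler_norml ltr_norml; set u := #|_|%:R^-1; lra.
have := Delta_TI R sKG sLG tiKL; move: (invq _ leK) (invq _ leL) near_x.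
by rewrite ltr_norml; lra.
Unshelve. all: by end_near.
Qed.
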